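(* Let $G=(V,E)$ be a finite connected graph. Assume $$\mathbb{E}_g \operatorname{Ric}\cdot \mathbb{E} d= \mathbb{E}\operatorname{Deg}.$$ Then $G$ is reflective.
   Context: A finite graph $G=(V,E)$ consists of a finite (nonempty) vertex set $V$ and a symmetric relation $E\subset V^2$ with empty diagonal; $x\sim y$ means $(x,y)\in E$. The graph distance is $d(x,y)=\inf\{n: x=x_0\sim\dots\sim x_n=y\}$, and $G$ is connected if $d<\infty$. The Laplacian is $\Delta f(x)=\sum_{y\sim x}(f(y)-f(x))$ for $f:V\to\mathbb{R}$, and $\operatorname{Deg}(x)=\Delta d(x,\cdot)(x)$ is the number of neighbours of $x$. Averages: $\mathbb{E}\operatorname{Deg}=\frac1{|V|}\sum_{x\in V}\operatorname{Deg}(x)$ and $\mathbb{E}d=\frac1{|V|^2}\sum_{x,y\in V}d(x,y)$ (including $x=y$). Edge betweenness centrality: $g(e)=\frac1{|V|^2}\sum_{x,y\in V}\frac1{|P_{xy}|}\sum_{p\in P_{xy}}1_{e\in p}$, where $P_{xy}$ is the set of shortest paths from $x$ to $y$; a path $x_0\sim\dots\sim x_n$ from $x$ to $y$ contains the edges $(x_{k-1},x_k)$, $1\le k\le n$. Ollivier curvature: for $x\ne y$, $$\operatorname{Ric}(x,y)=\inf_{\substack{\|\nabla f\|_\infty=1\\ f(y)-f(x)=d(x,y)}}\frac{\Delta f(x)-\Delta f(y)}{d(x,y)},\qquad \|\nabla f\|_\infty=\sup_{u\sim v}|f(u)-f(v)|,$$ the infimum being over $f:V\to\mathbb{R}$;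 for an edge $e=(x,y)$, $\operatorname{Ric}(e)=\operatorname{Ric}(x,y)$. The weighted average curvature is $$\mathbb{E}_g\operatorname{Ric}=\frac{\sum_{e\in E}g(e)\operatorname{Ric}(e)}{\sum_{e\in E}g(e)},$$ where in the degenerate case $|V|=1$ the quotient $0/0$ is read as $0$. Reflective graphs: for $x\sim y$ let $V_x^y=\{z\in V: d(x,z)<d(y,z)\}$ (so $V_y^x=\{z\in V: d(y,z)<d(x,z)\}$) and $V^{xy}=\{z\in V: d(x,z)=d(y,z)\}$. For $A,B\subset V$ let $E(A,B)=\{(a,b)\in E: a\in A,\ b\in B\}$. A map $\phi:V\to V$ is called a reflection from $x$ to $y$ if: (a) $\phi(x)=y$; (b) $\phi(z)=z$ for all $z\in V^{xy}$; (c) $\phi^2=\mathrm{id}$; (d) $E(V_x^y,V_y^x)=\{(z,\phi(z)): z\in V_x^y\}$; (e) $\phi$ is a graph automorphism. $G$ is called reflective if for all $x\sim y$ there exists a reflection from $x$ to $y$. *)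

(* Defs.v *)
From HB Require Import structures.
From mathcomp Require Import all_boot all_order all_algebra.
From mathcomp Require Import boolp classical_sets reals.
Set Implicit Arguments.
Unset Strict Implicit.
Unset Printing Implicit Defensive.
Import Order.TTheory GRing.Theory Num.Theory.
Local Open Scope ring_scope.

(* A finite graph is given by its vertex type V and its adjacency relation
   E : rel V; edges are ordered pairs, so each undirected edge occurs in both
   directions in all the sums over edges below. *)

(* The tuple p lists x_1, ..., x_n; the starting vertex x_0 = x is implicit. *)
Definition walk (V : finType) (E : rel V) (x y : V) (n : nat)
    (p : n.-tuple V) : bool :=
  path E x p && (last x p == y).

(* The value 0 is junk, reached only when there is no walk from x to y; this
   never happens in a connected graph. *)
Definition dist (V : finType) (E : rel V) (x y : V) : nat :=
  if pselect (exists n, [exists p : n.-tuple V, walk E x y p]) is left h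
  then ex_minn h else 0%N.

Definition laplacian (R : realType) (V : finType) (E : rel V)
    (f : V -> R) (x : V) : R :=
  \sum_(y | E x y) (f y - f x).

Definition deg (R : realType) (V : finType) (E : rel V) (x : V) : R :=
  laplacian E (fun z => (dist E x z)%:R) x.

Definition avg_deg (R : realType) (V : finType) (E : rel V) : R :=
  (#|V|%:R)^-1 * \sum_x deg R E x.

Definition avg_dist (R : realType) (V : finType) (E : rel V) : R :=
  (#|V|%:R ^+ 2)^-1 * \sum_x \sum_y (dist E x y)%:R.

Definition geodesics (V : finType) (E : rel V) (x y : V) :
    {set (dist E x y).-tuple V} :=
  [set p | walk E x y p]%SET.

(* The pairs (x_{k-1}, x_k), 1 <= k <= n. *)
Definition path_edges (V : finType) (x : V) (p : seq V) : seq (V * V) :=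
  zip (belast x p) p.

Definition betweenness (R : realType) (V : finType) (E : rel V)
    (a : V * V) : R :=
  (#|V|%:R ^+ 2)^-1 *
  \sum_x \sum_y (#|geodesics E x y|%:R)^-1 *
    \sum_(p in geodesics E x y) (a \in path_edges x p)%:R.

Definition grad_norm (R : realType) (V : finType) (E : rel V)
    (f : V -> R) : R :=
  sup [set `|f a.1 - f a.2| | a in [set a : V * V | E a.1 a.2]]%classic.

Definition ric (R : realType) (V : finType) (E : rel V) (x y : V) : R :=
  inf [set (laplacian E f x - laplacian E f y) / (dist E x y)%:R
      | f in [set f : V -> R |
               grad_norm E f = 1 /\ f y - f x = (dist E x y)%:R]]%classic.

(* When #|V| = 1 both sums are empty and the quotient is 0, since 0^-1 = 0. *)
Definition avg_ric (R : realType) (V : finType) (E : rel V) : R :=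
  (\sum_(a : V * V | E a.1 a.2) betweenness R E a * ric R E a.1 a.2) /
  (\sum_(a : V * V | E a.1 a.2) betweenness R E a).

(* V_x^y *)
Definition closer (V : finType) (E : rel V) (x y : V) : {set V} :=
  [set z | (dist E x z < dist E y z)%N]%SET.

(* V^{xy} *)
Definition equidistant (V : finType) (E : rel V) (x y : V) : {set V} :=
  [set z | dist E x z == dist E y z]%SET.

(* E(A, B) *)
Definition edges_between (V : finType) (E : rel V) (A B : {set V}) :
    {set V * V} :=
  [set a | [&& E a.1 a.2, a.1 \in A & a.2 \in B]]%SET.

Definition automorphism (V : finType) (E : rel V) (phi : V -> V) : Prop :=
  bijective phi /\ forall u v, E (phi u) (phi v) = E u v.

Definition reflection (V : finType) (E : rel V) (x y : V) (phi : V -> V) :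
    Prop :=
  [/\ phi x = y,
      {in equidistant E x y, forall z, phi z = z},
      involutive phi,
      edges_between E (closer E x y) (closer E y x)
        = [set (z, phi z) | z in closer E x y]%SET
    & automorphism E phi].

Definition reflective (V : finType) (E : rel V) : Prop :=
  forall x y, E x y -> exists phi : V -> V, reflection E x y phi.

(* Main.v *)
Require Import Defs.
From HB Require Import structures.
From mathcomp Require Import all_boot all_order all_algebra.
From mathcomp Require Import boolp classical_sets reals.
From mathcomp Require Import zify ring lra.
Set Implicit Arguments.
Unset Strict Implicit.
Unset Printing Implicit Defensive.
Import Order.TTheory GRing.Theory Num.Theory.
Local Open Scope ring_scope.

(** Write L_z for the Laplacian of d(z, -). If (u, v) is an edge and v is one
    step farther from z than u, then d(z, -) competes in the infimum defining
    the curvature of (u, v), so Ric(u, v) <= L_z(u) - L_z(v). Along a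
    geodesic from z to y these bounds telescope to Deg(z) - L_z(y); averaging
    over all geodesics and all pairs (z, y), and using that a Laplacian has
    zero total, gives sum_e g(e) Ric(e) <= E Deg. Since the total weight
    sum_e g(e) is E d, the hypothesis is equality here, which forces equality
    in every single estimate: each d(z, -) is an optimal test function for
    each edge along which it increases ([rigid_ric]).

    Fix now an edge (x, y). All the functions d(z, -) with z nearer to x, and
    - d(z, -) with z nearer to y, are optimal simultaneously, hence so is their
    sum H. Lowering H by 1 on a set W that no edge of full slope leaves
    keeps H a competitor, and comparing Laplacians shows that such a W
    avoiding x and y meets the neighbours of y whenever it meets those of x. Choosing W as the
    set reached from a neighbour a of x by moving along all these functions at
    full slope yields a neighbour b of both a and y such that (a, b) cuts V
    into the same two sides as (x, y) ([closer_neighbour],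
    [closer_edge_neighbour]).

    Transporting the edge (x, y) in this way along geodesics from x, and
    from y, attaches to every z on the x side a unique edge (z, b) that
    induces the same two sides ([partner_ex], [partner_uniq]). Exchanging
    the ends of these edges and fixing all equidistant vertices is the
    reflection. *)

(** * Graph distance *)

Section Distance.

Context (V : finType) (E : rel V).
Hypothesis E_sym : symmetric E.
Hypothesis E_connected : forall x y : V, connect E x y.

Local Notation d := (dist E).

Lemma dist_spec x y :
  (exists p, [/\ path E x p, last x p = y & size p = d x y]) /\
  (forall p, path E x p -> last x p = y -> (d x y <= size p)%N).
Proof.
have walk_ex : exists n, [exists p : n.-tuple V, walk E x y p].
  have /connectP[p xp ->] := E_connected x y.
  by exists (size p); apply/existsP; exists (in_tuple p); rewrite /walk xp /=.
rewrite /dist; case: pselect => [h|/(_ walk_ex)//].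
case: ex_minnP => n /existsP[p /andP[xp /eqP py]] n_min; split.
  by exists p; rewrite size_tuple.
move=> q xq qy; apply: n_min; apply/existsP; exists (in_tuple q).
by rewrite /walk xq qy eqxx.
Qed.

Lemma geodesic_ex x y :
  exists p, [/\ path E x p, last x p = y & size p = d x y].
Proof. by have [] := dist_spec x y. Qed.

Lemma dist_le_size x p : path E x p -> (d x (last x p) <= size p)%N.
Proof. by move=> xp; have [_] := dist_spec x (last x p); apply. Qed.

Lemma distxx x : d x x = 0%N.
Proof. by apply/eqP; rewrite -leqn0; apply: (@dist_le_size x [::]). Qed.

Lemma dist_eq0 x y : d x y = 0%N -> x = y.
Proof. by have [[|w p] [_ /= <- <-]] := geodesic_ex x y. Qed.

Lemma dist_triangle x y z : (d x z <= d x y + d y z)%N.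
Proof.
have [p [xp py <-]] := geodesic_ex x y; have [q [yq qz <-]] := geodesic_ex y z.
rewrite -size_cat -qz -py -last_cat dist_le_size //.
by rewrite cat_path xp py.
Qed.

Lemma distC x y : d x y = d y x.
Proof.
suff le_d u v : (d u v <= d v u)%N by apply/eqP; rewrite eqn_leq !le_d.
have [p [vp pu <-]] := geodesic_ex v u.
have := @dist_le_size u (rev (belast v p)).
rewrite -pu rev_path (eq_path (e' := E)) => [/(_ vp)|a b /=]; last exact: E_sym.
rewrite size_rev size_belast; case: p {vp pu} => [|w p] //=.
by rewrite rev_cons last_rcons.
Qed.

Lemma dist_edge_le x y : E x y -> (d x y <= 1)%N.
Proof. by move=> xy; apply: (@dist_le_size x [:: y]); rewrite /= xy. Qed.

Lemma dist1_edge x y : d x y = 1%N -> E x y.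
Proof.
have [[|a [|b p]] [/= xp <- <-]] := geodesic_ex x y => // _.
by case/andP: xp.
Qed.

Lemma dist_edge_lip z u v : E u v -> (d z v <= (d z u).+1)%N.
Proof.
move=> /dist_edge_le uv; apply: leq_trans (dist_triangle z u v) _.
by rewrite -addn1 leq_add2l.
Qed.

Lemma dist_pred x z n :
  d x z = n.+1 -> exists w, d x w = n /\ E w z.
Proof.
have [p [xp pz sp]] := geodesic_ex x z; move: sp.
elim/last_ind: p xp pz => [_ _ <- //|p w _].
rewrite rcons_path last_rcons size_rcons => /andP[xp pw] wz sp [dz].
subst w; exists (last x p); split=> //.
have := dist_le_size xp; have := dist_edge_lip x pw; lia.
Qed.

End Distance.

(** * Laplacian and Ollivier curvature *)

Section Curvature.

Context (R : realType) (V : finType) (E : rel V).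
Hypothesis E_sym : symmetric E.
Hypothesis E_irrefl : irreflexive E.
Hypothesis E_connected : forall x y : V, connect E x y.

Local Notation d := (dist E).
Local Notation L := (laplacian E).
Implicit Types (f g : V -> R) (k : R).

Lemma dist_edge x y : E x y -> d x y = 1%N.
Proof.
move=> xy; apply/eqP; rewrite eqn_leq dist_edge_le // lt0n.
by apply: contraTneq xy => /(dist_eq0 E_connected)->; rewrite E_irrefl.
Qed.

Lemma laplacianN f x : L (fun z => - f z) x = - L f x.
Proof. by rewrite /laplacian -sumrN; apply: eq_bigr => y _; ring. Qed.

Lemma laplacianD f g x : L (fun z => f z + g z) x = L f x + L g x.
Proof. by rewrite /laplacian -big_split; apply: eq_bigr => y _ /=; ring. Qed.

Lemma laplacianZ k f x : L (fun z => k * f z) x = k * L f x.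
Proof. by rewrite /laplacian mulr_sumr; apply: eq_bigr => y _; ring. Qed.

Lemma laplacian_sum (I : finType) (P : pred I) (F : I -> V -> R) x :
  L (fun z => \sum_(i | P i) F i z) x = \sum_(i | P i) L (F i) x.
Proof.
rewrite /laplacian exchange_big; apply: eq_bigr => y _.
by rewrite -sumrB.
Qed.

(** Each undirected edge contributes the difference of its end values twice,
    with opposite signs. *)
Lemma sum_laplacian f : \sum_x L f x = 0.
Proof.
have : \sum_x L f x = - \sum_x L f x; last by lra.
rewrite -sumrN {1}/laplacian (exchange_big_dep xpredT) //=.
apply: eq_bigr => x _; rewrite /laplacian -sumrN.
by apply: eq_big => [y|y _]; [exact: E_sym | rewrite opprB].
Qed.

Lemma grad_norm_le f u v : E u v -> `|f u - f v| <= grad_norm E f.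
Proof.
move=> uv; apply: ub_le_sup; last by exists (u, v).
exists (\sum_(a : V * V) `|f a.1 - f a.2|) => _ [a _ <-].
by rewrite (bigD1 a) //= lerDl sumr_ge0.
Qed.

(** By symmetry of [E] the one-sided bound controls absolute values, and the
    edge (x, y) attains the supremum. *)
Lemma grad_norm_unit f x y :
  (forall u v, E u v -> f v - f u <= 1) -> E x y -> f y - f x = 1 ->
  grad_norm E f = 1.
Proof.
move=> f_lip xy fxy; apply: le_anti; apply/andP; split.
  apply: ge_sup => [|_ [[u v] /= uv <-]].
    by exists `|f x - f y|, (x, y).
  have vu : E v u by rewrite E_sym.
  by rewrite ler_norml; move: (f_lip _ _ uv) (f_lip _ _ vu); lra.
by rewrite (le_trans _ (grad_norm_le f xy)) // distrC fxy normr1.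
Qed.

(** Besides exhibiting a competitor, this needs the infimum to be taken over a
    set bounded below: the Laplacian of a function of unit gradient norm is at
    most |V| in absolute value. *)
Lemma ric_le f x y :
  (forall u v, E u v -> f v - f u <= 1) -> E x y -> f y - f x = 1 ->
  ric R E x y <= L f x - L f y.
Proof.
move=> f_lip xy fxy; apply: ge_inf; last first.
  exists f; last by rewrite dist_edge // divr1.
  by rewrite dist_edge //; split=> //; apply: grad_norm_unit f_lip xy fxy.
have lap_le g u : grad_norm E g = 1 -> `|L g u| <= #|V|%:R.
  move=> g1; rewrite (le_trans (ler_norm_sum _ _ _)) //.
  rewrite -sum1_card natr_sum [leRHS](bigID (E u)) /=.
  rewrite -[leLHS]addr0 lerD ?sumr_ge0 //.
  by apply: ler_sum => v uv; rewrite distrC -g1 grad_norm_le.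
exists (- (#|V|%:R + #|V|%:R)) => _ [g [g1 _] <-]; rewrite dist_edge // divr1.
move: (lap_le g x g1) (lap_le g y g1); rewrite !ler_norml; lra.
Qed.

(** The form needed for a sum of k test functions. *)
Lemma ric_le_scaled k f x y : 0 < k ->
  (forall u v, E u v -> f v - f u <= k) -> E x y -> f y - f x = k ->
  k * ric R E x y <= L f x - L f y.
Proof.
move=> k0 f_lip xy fxy; rewrite mulrC -ler_pdivlMr // mulrC mulrBr -!laplacianZ.
apply: ric_le => // [u v /f_lip|]; last by rewrite -mulrBr fxy mulVf // gt_eqF.
by rewrite -mulrBr ler_pdivrMl // mulr1.
Qed.

(** Negation is a bijection between the competitors for (x, y) and (y, x). *)
Lemma ricC x y : ric R E x y = ric R E y x.
Proof.
suff sub u v : 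
  ([set (L f u - L f v) / (d u v)%:R | f in
     [set f : V -> R | grad_norm E f = 1 /\ f v - f u = (d u v)%:R]] `<=`
   [set (L f v - L f u) / (d v u)%:R | f in
     [set f : V -> R | grad_norm E f = 1 /\ f u - f v = (d v u)%:R]])%classic.
  by congr inf; apply/seteqP; split; apply: sub.
move=> _ [f [f1 fuv] <-]; exists (fun z => - f z); last first.
  by rewrite !laplacianN (distC E_sym E_connected v u); congr (_ / _); ring.
split; last by rewrite (distC E_sym E_connected v u) -fuv; ring.
rewrite -f1; congr sup; apply/seteqP; split=> _ [a aE <-]; exists a => //;
  by rewrite -[LHS]normrN; congr Num.norm; ring.
Qed.

Lemma dist_lip z u v : E u v -> (d z v)%:R - (d z u)%:R <= 1 :> R.
Proof.
by move=> /(dist_edge_lip E_connected z); rewrite -(ler_nat R) -natr1; lra.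
Qed.

Lemma ric_le_dist z u v : E u v -> d z v = (d z u).+1 ->
  ric R E u v <= L (fun w => (d z w)%:R) u - L (fun w => (d z w)%:R) v.
Proof.
move=> uv zuv; apply: ric_le => // [a b|]; first exact: dist_lip.
by rewrite zuv -natr1; ring.
Qed.

End Curvature.

(** * Averaging over geodesics, and the equality case *)

Section Geodesics.

Context (R : realType) (V : finType) (E : rel V).
Hypothesis E_sym : symmetric E.
Hypothesis E_irrefl : irreflexive E.
Hypothesis E_connected : forall x y : V, connect E x y.

Local Notation d := (dist E).
Local Notation L := (laplacian E).

Lemma path_edges_rcons (x : V) p y :
  path_edges x (rcons p y) = rcons (path_edges x p) (last x p, y).
Proof.
by elim: p x => //= z p IHp x; rewrite /path_edges /= -/(path_edges _ _) IHp.
Qed.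

Lemma size_path_edges (x : V) p : size (path_edges x p) = size p.
Proof. by rewrite /path_edges size_zip size_belast minnn. Qed.

Lemma sum_path_edges_telescope (F : V -> R) x p :
  \sum_(e <- path_edges x p) (F e.1 - F e.2) = F x - F (last x p).
Proof.
elim/last_ind: p => [|p y IHp]; first by rewrite big_nil subrr.
by rewrite path_edges_rcons big_rcons /= IHp last_rcons; ring.
Qed.

Lemma path_edges_edge x p e : path E x p -> e \in path_edges x p -> E e.1 e.2.
Proof.
elim/last_ind: p => [|p y IHp] //.
rewrite rcons_path path_edges_rcons mem_rcons in_cons => /andP[xp py].
by case/predU1P => [->|/(IHp xp)].
Qed.

(** Every prefix of a shortest path is shortest, so the distance from x grows
    by one along each edge; in particular no edge is repeated. *)
Lemma shortest_path_edges x p :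
  path E x p -> size p = d x (last x p) ->
  uniq (path_edges x p) /\
  forall e, e \in path_edges x p ->
    d x e.2 = (d x e.1).+1 /\ (d x e.2 <= size p)%N.
Proof.
elim/last_ind: p => [|p y IHp] //.
rewrite rcons_path last_rcons size_rcons => /andP[xp py] size_p.
have dp := dist_le_size E_connected xp.
have dy := dist_edge_lip E_connected x py.
have {IHp} [|uniq_p edge_p] := IHp xp; first by lia.
rewrite path_edges_rcons rcons_uniq uniq_p; split=> [|e].
  by rewrite andbT; apply/negP => /edge_p /= []; lia.
rewrite mem_rcons in_cons => /predU1P[-> /=|/edge_p[]]; split=> //; lia.
Qed.

Lemma geodesicsP x y (p : (d x y).-tuple V) : p \in geodesics E x y ->
  [/\ path E x p, last x p = y & size p = d x (last x p)].
Proof. by rewrite inE => /andP[xp /eqP py]; rewrite size_tuple py. Qed.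

Lemma geodesics_gt0 x y : 0 < #|geodesics E x y|%:R :> R.
Proof.
rewrite ltr0n card_gt0; have [p [xp py /eqP sp]] := geodesic_ex E_connected x y.
by apply/set0Pn; exists (Tuple sp); rewrite inE /walk xp py eqxx.
Qed.

Lemma geodesics_through z u v : E u v -> d z v = (d z u).+1 ->
  exists2 p : (d z v).-tuple V,
    p \in geodesics E z v & (u, v) \in path_edges z p.
Proof.
move=> uv zuv; have [p [zp pu sp]] := geodesic_ex E_connected z u.
have sp' : size (rcons p v) == d z v by rewrite size_rcons sp zuv.
exists (Tuple sp'); first by rewrite inE /walk rcons_path zp pu uv last_rcons /=.
by rewrite path_edges_rcons mem_rcons pu mem_head.
Qed.

(** Double counting: weighting edges by betweenness is averaging over geodesics
    and pairs of end points. Exchanging the sums is legitimate because a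
    geodesic lists each of its edges once. *)
Lemma sum_betweenness (c : V * V -> R) :
  \sum_(e | E e.1 e.2) betweenness R E e * c e =
  (#|V|%:R ^+ 2)^-1 * \sum_x \sum_y (#|geodesics E x y|%:R)^-1 *
    \sum_(p in geodesics E x y) \sum_(e <- path_edges x p) c e.
Proof.
rewrite /betweenness; under eq_bigr do rewrite -mulrA.
rewrite -mulr_sumr; congr (_ * _).
under eq_bigr do rewrite mulr_suml.
rewrite exchange_big; apply: eq_bigr => x _ /=.
under eq_bigr do rewrite mulr_suml.
rewrite exchange_big; apply: eq_bigr => y _ /=.
under eq_bigr do rewrite -mulrA mulr_suml.
rewrite -mulr_sumr exchange_big; congr (_ * _); apply: eq_bigr => p /geodesicsP.
move=> [xp _ /(shortest_path_edges xp)[uniq_p _]] /=.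
rewrite [RHS]big_uniq //= [RHS]big_mkcond [LHS]big_mkcond.
apply: eq_bigr => e _; have := @path_edges_edge x p e xp.
by case: (e \in _) => [->//|_]; rewrite ?mul1r ?mul0r ?if_same.
Qed.

Lemma sum_betweenness1 :
  \sum_(e | E e.1 e.2) betweenness R E e = avg_dist R E.
Proof.
under eq_bigr do rewrite -[betweenness _ _ _]mulr1.
rewrite sum_betweenness; congr (_ * _).
apply: eq_bigr => x _; apply: eq_bigr => y _.
under eq_bigr => p do rewrite big_const_seq count_predT iter_addr_0
  size_path_edges size_tuple.
by rewrite sumr_const -[X in _ * X]mulr_natl mulKf // gt_eqF // geodesics_gt0.
Qed.

Hypothesis rigid : avg_ric R E * avg_dist R E = avg_deg R E.

(** The defect of an edge is the slack in [ric_le_dist]. All defects along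
    geodesics are nonnegative and, by telescoping and the rigidity hypothesis,
    their weighted sum vanishes, so each of them vanishes; (u, v) is the last
    edge of some geodesic from z. *)
Lemma rigid_ric z u v : E u v -> d z v = (d z u).+1 ->
  ric R E u v = L (fun w => (d z w)%:R) u - L (fun w => (d z w)%:R) v.
Proof.
move=> uv zuv.
pose N : R := #|V|%:R; pose Lap x := L (fun w => (d x w)%:R : R).
have N_gt0 : 0 < N by rewrite ltr0n; apply/card_gt0P; exists z.
pose defect x (e : V * V) := Lap x e.1 - Lap x e.2 - ric R E e.1 e.2.
have defect_ge0 x y (p : (d x y).-tuple V) e :
    p \in geodesics E x y -> e \in path_edges x p -> 0 <= defect x e.
  move=> /geodesicsP[xp _ /(shortest_path_edges xp)[_ edge_p]] ep.
  have [e_d _] := edge_p e ep; rewrite subr_ge0.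
  exact: ric_le_dist (path_edges_edge xp ep) e_d.
(* An edge exists, so the average distance is nonzero and the quotient
   defining the weighted average curvature can be cancelled. *)
have sum_ric : \sum_x \sum_y (#|geodesics E x y|%:R)^-1 *
    \sum_(p in geodesics E x y) \sum_(e <- path_edges x p) ric R E e.1 e.2
    = N * \sum_x deg R E x.
  have dist_gt0 : 0 < avg_dist R E.
    rewrite mulr_gt0 ?invr_gt0 ?exprn_gt0 // (bigD1 u) //= ltr_wpDr //.
      by do 2!apply: sumr_ge0 => ? _.
    rewrite (bigD1 v) //= ltr_wpDr //; first by apply: sumr_ge0.
    by rewrite dist_edge // ltr01.
  move: rigid; rewrite /avg_ric sum_betweenness1 divfK ?gt_eqF //.
  rewrite (sum_betweenness (fun e => ric R E e.1 e.2)) /avg_deg -/N.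
  move/(congr1 ( *%R (N ^+ 2))); rewrite mulVKf ?gt_eqF ?exprn_gt0 // => ->.
  by rewrite expr2 mulrA mulfK ?gt_eqF.
have sum_lap : \sum_x \sum_y (#|geodesics E x y|%:R)^-1 *
    \sum_(p in geodesics E x y) \sum_(e <- path_edges x p) (Lap x e.1 - Lap x e.2)
    = N * \sum_x deg R E x.
  rewrite mulr_sumr; apply: eq_bigr => x _.
  transitivity (\sum_y (deg R E x - Lap x y)).
    apply: eq_bigr => y _.
    under eq_bigr => p /geodesicsP[_ py _] do rewrite sum_path_edges_telescope py.
    rewrite sumr_const -[X in _ * X]mulr_natl mulKf // gt_eqF //.
    exact: geodesics_gt0.
  by rewrite sumrB sum_laplacian // subr0 sumr_const -mulr_natl.
have sum_defect : \sum_x \sum_y (#|geodesics E x y|%:R)^-1 *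
    \sum_(p in geodesics E x y) \sum_(e <- path_edges x p) defect x e = 0.
  rewrite -[RHS](subrr (N * \sum_x deg R E x)) -{1}sum_lap -sum_ric -sumrB.
  apply: eq_bigr => x _; rewrite -sumrB; apply: eq_bigr => y _.
  rewrite -mulrBr -sumrB; congr (_ * _); apply: eq_bigr => p _.
  by rewrite -sumrB.
have path_ge0 x y (p : (d x y).-tuple V) : p \in geodesics E x y ->
    0 <= \sum_(e <- path_edges x p) defect x e.
  by move=> pG; rewrite big_seq sumr_ge0 // => e; apply: defect_ge0 pG.
have pair_ge0 x y : 0 <= (#|geodesics E x y|%:R)^-1 *
    \sum_(p in geodesics E x y) \sum_(e <- path_edges x p) defect x e.
  by rewrite mulr_ge0 ?invr_ge0 // sumr_ge0 // => p; apply: path_ge0.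
have vertex_ge0 x : 0 <= \sum_y (#|geodesics E x y|%:R)^-1 *
    \sum_(p in geodesics E x y) \sum_(e <- path_edges x p) defect x e.
  by apply: sumr_ge0 => y _; apply: pair_ge0.
have /(_ z isT) := psumr_eq0P (fun x _ => vertex_ge0 x) sum_defect.
move=> /(psumr_eq0P (fun y _ => pair_ge0 z y))/(_ v isT)/eqP.
rewrite mulf_eq0 invr_eq0 gt_eqF ?geodesics_gt0 //= => /eqP pair0.
have [p pG uvp] := geodesics_through uv zuv.
have /(_ p pG) := psumr_eq0P (@path_ge0 z v) pair0.
move=> /eqP; rewrite big_seq psumr_eq0 => [|e]; last exact: defect_ge0 pG.
by move=> /allP/(_ _ uvp)/implyP/(_ uvp); rewrite subr_eq0 => /eqP.
Qed.

End Geodesics.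

(** * Transporting an edge to a neighbouring vertex *)

Section Parallel.

Context (R : realType) (V : finType) (E : rel V).
Hypothesis E_sym : symmetric E.
Hypothesis E_irrefl : irreflexive E.
Hypothesis E_connected : forall x y : V, connect E x y.

Local Notation d := (dist E).
Local Notation L := (laplacian E).
Local Notation dC := (distC E_sym E_connected).

Hypothesis dist_optimal : forall z u v, E u v -> d z v = (d z u).+1 ->
  ric R E u v = L (fun w => (d z w)%:R) u - L (fun w => (d z w)%:R) v.

(** The distances from z to the two ends of an edge differ by at most one. *)
Lemma closerE x y z : E x y -> (z \in closer E x y) = (d z y == (d z x).+1).
Proof.
move=> xy; rewrite inE (dC x) (dC y).
have := dist_edge_lip E_connected z xy.
by case: ltngtP; lia.
Qed.

(** Here b is a vertex to which an optimal transport between the neighbourhoods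
    of x and y would move mass from a. The argument is the dual one: if no
    neighbour of y were reachable from a by steepest ascent along all optimal
    test functions at once, lowering their sum on the set W of reachable
    vertices would produce a test function better than optimal. *)
Lemma closer_neighbour x y a : E x y -> E x a -> d y a = 2%N ->
  exists b, [/\ E y b, E a b,
    closer E x y \subset closer E a b & closer E y x \subset closer E b a].
Proof.
move=> xy xa ya; have yx : E y x by rewrite E_sym.
pose P := closer E x y :|: closer E y x.
pose h z w : R := if z \in closer E x y then (d z w)%:R else - (d z w)%:R.
have h_lip z u v : E u v -> h z v - h z u <= 1.
  move=> uv; have vu : E v u by rewrite E_sym.
  move: (dist_lip R E_connected z uv) (dist_lip R E_connected z vu).
  by rewrite /h; case: ifP => _; lra.
have h_lip_dist z u v : h z v - h z u <= (d u v)%:R.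
  have := dist_triangle E_connected z u v.
  have := dist_triangle E_connected z v u.
  rewrite -!(ler_nat R) !natrD (dC v u) /h; case: ifP => _; lra.
have h_step z u v : E u v -> h z v - h z u = 1 \/ h z v - h z u <= 0.
  move=> uv; have vu : E v u by rewrite E_sym.
  have zv := dist_edge_lip E_connected z uv.
  have zu := dist_edge_lip E_connected z vu.
  rewrite /h; case: ifP => _.
    case: (leqP (d z v) (d z u)) => [le|lt]; first by right; rewrite subr_le0 ler_nat.
    left; have -> : d z v = (d z u).+1 by lia.
    by rewrite -natr1; ring.
  case: (leqP (d z u) (d z v)) => [le|lt].
    by right; rewrite subr_le0 lerN2 ler_nat.
  left; have -> : d z u = (d z v).+1 by lia.
  by rewrite -natr1; ring.
have h_optimal z : z \in P -> h z y - h z x = 1 /\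
    ric R E x y = L (h z) x - L (h z) y.
  rewrite finset.in_setU /h; case: ifP => [zx _|_ /= zy].
    have zyx : d z y = (d z x).+1 by apply/eqP; rewrite -closerE.
    by rewrite zyx; split; [rewrite -natr1; ring | exact: dist_optimal].
  have zxy : d z x = (d z y).+1 by apply/eqP; rewrite -closerE.
  rewrite zxy; split; first by rewrite -natr1; ring.
  rewrite (ricC R E_sym E_connected) (dist_optimal yx zxy) !laplacianN; ring.
have xP : x \in P.
  by rewrite finset.in_setU closerE // distxx // dist_edge.
have x_closer : x \in closer E x y.
  by rewrite closerE // distxx // dist_edge.
(* W is closed under steepest ascent, so subtracting its indicator from the
   sum of the h z does not increase the largest slope |P|. *)
pose W := [set w | [forall z in P, h z w == h z a + (d a w)%:R]]%SET.
have W_spec w : w \in W -> forall z, z \in P -> h z w = h z a + (d a w)%:R.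
  by rewrite inE => /forallP W_w z zP; have /implyP/(_ zP)/eqP := W_w z.
pose one w : R := (w \in W)%:R.
pose H w := \sum_(z in P) h z w.
have G_lip u v : E u v -> (H v - one v) - (H u - one u) <= #|P|%:R.
  move=> uv.
  have HB : H v - H u = \sum_(z in P) (h z v - h z u) by rewrite -sumrB.
  have H_lip : H v - H u <= #|P|%:R.
    by rewrite HB -sum1_card natr_sum; apply: ler_sum => z _; apply: h_lip.
  rewrite /one; have [uW|_] := boolP (u \in W); last first.
    by case: (v \in W) => /=; move: H_lip; lra.
  have [_|vW] := boolP (v \in W); first by move: H_lip; lra.
  suff : H v - H u + 1 <= #|P|%:R by rewrite /=; lra.
  (* Only the case u in W, v outside W could violate the bound. Then some h z
     fails to climb from u to v, and being integral it loses a full unit. *)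
  move: vW; rewrite inE negb_forall => /existsP[z].
  rewrite negb_imply => /andP[zP /eqP hzv].
  have hzvu : h z v - h z u <= 0.
    have [step|//] := h_step z u v uv; case: hzv; apply: le_anti.
    have := h_lip_dist z a v; have := W_spec u uW z zP.
    have := dist_edge_lip E_connected a uv; rewrite -(ler_nat R) -natr1.
    by move: step => ? ? ? ?; apply/andP; split; lra.
  rewrite HB -sum1_card natr_sum !(bigD1 z zP) /=.
  have : \sum_(i in P | i != z) (h i v - h i u) <=
         \sum_(i in P | i != z) 1%:R.
    by apply: ler_sum => i _; apply: h_lip.
  move: hzvu; lra.
have hx w : h x w = (d x w)%:R by rewrite /h x_closer.
have xW : x \notin W.
  apply/negP => /W_spec/(_ x xP); rewrite !hx distxx // (dC a x) dist_edge //; lra.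
have yW : y \notin W.
  apply/negP => /W_spec/(_ x xP); rewrite !hx (dC a y) ya !dist_edge //; lra.
have lap_one u : u \notin W -> L one u = \sum_(v | E u v) one v.
  by move=> uW; apply: eq_bigr => v _; rewrite /one (negbTE uW) subr0.
have HP : L H x - L H y = #|P|%:R * ric R E x y.
  rewrite !laplacian_sum -sumrB mulr_natl -sumr_const.
  by apply: eq_bigr => z /h_optimal[_ ->].
have Gxy : (H y - one y) - (H x - one x) = #|P|%:R.
  rewrite /one (negbTE xW) (negbTE yW) !subr0 -sumrB -sum1_card natr_sum.
  by apply: eq_bigr => z /h_optimal[-> _].
have P_gt0 : 0 < #|P|%:R :> R by rewrite ltr0n; apply/card_gt0P; exists x.
(* The curvature terms cancel, leaving that W contains at least as many
   neighbours of y as of x. *)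
have := ric_le_scaled E_sym E_irrefl E_connected P_gt0 G_lip xy Gxy.
rewrite !(laplacianD _ H) !(laplacianN _ one) !lap_one // => count_le.
have : \sum_(v | E x v) one v >= 1.
  have aW : a \in W.
    by rewrite inE; apply/forallP => z; rewrite distxx // addr0 eqxx implybT.
  by rewrite (bigD1 a) //= /one aW lerDl sumr_ge0.
move=> x_count.
have [b /andP[yb bW]|no_b] := pickP [pred b | E y b & b \in W]; last first.
  have y0 : \sum_(v | E y v) one v = 0.
    by apply: big1 => v yv; have := no_b v; rewrite /= yv /= /one => ->.
  by move: count_le HP x_count; rewrite y0; lra.
(* Evaluating h x, the distance from x, at b bounds d a b by 1. *)
have ab : E a b.
  apply: dist1_edge => //; apply/eqP; rewrite eqn_leq lt0n; apply/andP; split.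
    have := W_spec b bW x xP; rewrite !hx (dist_edge E_irrefl E_connected xa).
    have := dist_edge_lip E_connected x yb.
    rewrite (dist_edge E_irrefl E_connected xy) -!(ler_nat R); lra.
  apply: contra_eqN ya => /eqP/(dist_eq0 E_connected)->.
  by rewrite dist_edge.
have ba : E b a by rewrite E_sym.
have W_b z : z \in P -> h z b = h z a + 1.
  by move=> zP; rewrite (W_spec b bW z zP) dist_edge.
exists b; split=> //; apply/fintype.subsetP => z zC.
  have zP : z \in P by rewrite finset.in_setU zC.
  by have := W_b z zP; rewrite /h zC natr1 => /eqP; rewrite eqr_nat closerE.
have zP : z \in P by rewrite finset.in_setU zC orbT.
have zC' : (z \in closer E x y) = false.
  by apply/negbTE; move: zC; rewrite !inE -leqNgt => /ltnW.
have := W_b z zP; rewrite /h zC' => hz.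
rewrite closerE // -(eqr_nat R) -natr1; apply/eqP; lra.
Qed.

End Parallel.

(** * Construction of the reflection *)

Section Reflection.

Context (V : finType) (E : rel V).
Hypothesis E_sym : symmetric E.
Hypothesis E_irrefl : irreflexive E.
Hypothesis E_connected : forall x y : V, connect E x y.

Local Notation d := (dist E).
Local Notation C := (closer E).
Local Notation dC := (distC E_sym E_connected).

Hypothesis closer_neighbour_ex : forall x y a,
  E x y -> E x a -> d y a = 2%N ->
  exists b, [/\ E y b, E a b, C x y \subset C a b & C y x \subset C b a].

Definition partner x y z b := [&& E z b, C z b == C x y & C b z == C y x].

Lemma partnerC x y z b : partner x y z b = partner y x b z.
Proof. by rewrite /partner E_sym [X in _ && X]andbC. Qed.

Lemma partner_refl x y : E x y -> partner x y x y.
Proof. by move=> xy; rewrite /partner xy !eqxx. Qed.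

Lemma closer_self x y : E x y -> x \in C x y.
Proof. by move=> xy; rewrite closerE // distxx // dist_edge. Qed.

Lemma partner_closer x y z b : partner x y z b -> z \in C x y.
Proof. by case/and3P=> zb /eqP<- _; apply: closer_self. Qed.

Lemma closer_edge_eq z b w : E z b -> w \in C b z -> E z w -> w = b.
Proof.
move=> zb; rewrite inE => wC zw; apply/esym; apply: (dist_eq0 E_connected).
by move: wC; rewrite (dist_edge E_irrefl E_connected zw); lia.
Qed.

Lemma partner_uniq x y z b b' : partner x y z b -> partner x y z b' -> b = b'.
Proof.
move=> /and3P[zb _ /eqP bC] pb'; apply/esym; apply: (closer_edge_eq zb).
  by rewrite bC; apply: (@partner_closer _ _ _ z); rewrite -partnerC.
by case/and3P: pb'.
Qed.

(** The inclusions of [closer_neighbour] are equalities: applied again to the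
    edge (a, b) and the neighbour x of a, the same statement gives back an edge
    (x, c) with c = y, and the reverse inclusions. *)
Lemma closer_edge_neighbour x y a : E x y -> E x a -> d y a = 2%N ->
  exists2 b, E y b & partner x y a b.
Proof.
move=> xy xa ya; have [b [yb ab sub1 sub2]] := closer_neighbour_ex xy xa ya.
have [ax ba] : E a x /\ E b a by split; rewrite E_sym.
have bx : d b x = 2%N.
  have : x \in C a b by rewrite (fintype.subsetP sub1) ?closer_self.
  by rewrite closerE // (dC x) (dC x a) (dist_edge E_irrefl E_connected ax) => /eqP.
have [c [bc xc sub3 sub4]] := closer_neighbour_ex ab ax bx.
have cy : y = c.
  apply: (closer_edge_eq xc) => //; apply: (fintype.subsetP sub4).
  by apply: (fintype.subsetP sub2); apply: closer_self; rewrite E_sym.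
exists b => //; rewrite -cy in sub3 sub4.
by rewrite /partner ab !finset.eqEsubset sub1 sub2 sub3 sub4.
Qed.

(** One step of transport; since (u, b) induces the sides of (x, y), the vertex
    v of the x side is at distance 2 from b. This also provides the
    edge between b and b' that makes the reflection an automorphism. *)
Lemma partner_step x y u b v :
  partner x y u b -> v \in C x y -> E u v -> exists2 b', E b b' & partner x y v b'.
Proof.
case/and3P=> ub /eqP uC /eqP bC vC uv.
have bv : d b v = 2%N.
  move: vC; rewrite -uC closerE // (dC v) (dC v u).
  by rewrite (dist_edge E_irrefl E_connected uv) => /eqP.
have [b' bb' /and3P[vb' vC' bC']] := closer_edge_neighbour ub uv bv.
by exists b' => //; rewrite /partner vb' -uC -bC vC' bC'.
Qed.

(** Transport along a geodesic from x to z, which stays on the x side. *)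
Lemma partner_ex x y z : E x y -> z \in C x y -> exists b, partner x y z b.
Proof.
move=> xy zC; move: {2}(d x z) (erefl (d x z)) => n xz.
elim: n z xz zC => [|n IHn] z xz zC.
  by exists y; rewrite -(dist_eq0 E_connected xz) partner_refl.
have [w [xw wz]] := dist_pred E_connected xz.
have wC : w \in C x y.
  move: zC; rewrite !inE; have := dist_edge_lip E_connected y wz; lia.
have [b wb] := IHn w xw wC.
by have [b' _ zb'] := partner_step wb zC wz; exists b'.
Qed.

Lemma reflection_ex x y : E x y -> exists phi, reflection E x y phi.
Proof.
move=> xy; have yx : E y x by rewrite E_sym.
(* Q is symmetric and single-valued, so choosing partners is an involution. *)
pose Q z b := partner x y z b || partner y x z b.
have QC z b : Q z b = Q b z by rewrite /Q orbC partnerC [partner y x _ _]partnerC.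
have QP z b : Q z b -> (z \in C x y) || (z \in C y x).
  by case/orP => /partner_closer->; rewrite ?orbT.
have disj z : z \in C x y -> z \in C y x -> False by rewrite !inE; lia.
have Q_uniq z b b' : Q z b -> Q z b' -> b = b'.
  case/orP=> zb /orP[] zb'; try exact: partner_uniq zb zb'.
    by case: (disj z (partner_closer zb) (partner_closer zb')).
  by case: (disj z (partner_closer zb') (partner_closer zb)).
pose phi z := odflt z [pick b | Q z b].
have phiQ z b : Q z b -> phi z = b.
  rewrite /phi => zb; case: pickP => [b' zb'|/(_ b)]; last by rewrite zb.
  exact: Q_uniq zb' zb.
have phi_id z : z \in equidistant E x y -> phi z = z.
  rewrite /phi => zeq; case: pickP => [b /QP|//].
  by move: zeq; rewrite !inE; lia.
have trich z : [\/ exists2 b, partner x y z b & phi z = b,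
                   exists2 b, partner y x z b & phi z = b |
                   z \in equidistant E x y].
  have [zC|zNx] := boolP (z \in C x y).
    have [b zb] := partner_ex xy zC; apply: Or31; exists b => //.
    by apply: phiQ; rewrite /Q zb.
  have [zC|zNy] := boolP (z \in C y x).
    have [b zb] := partner_ex yx zC; apply: Or32; exists b => //.
    by apply: phiQ; rewrite /Q zb orbT.
  by apply: Or33; move: zNx zNy; rewrite !inE; lia.
have phiK : involutive phi.
  move=> z; have [[b zb ->]|[b zb ->]|zeq] := trich z; last by rewrite !phi_id.
    by apply: phiQ; rewrite QC /Q zb.
  by apply: phiQ; rewrite QC /Q zb orbT.
have cross z w : E z w -> z \in C x y -> w \in C y x -> phi z = w.
  move=> zw zC wC; have [b zb] := partner_ex xy zC.
  have -> : phi z = b by apply: phiQ; rewrite /Q zb.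
  case/and3P: zb => zb _ /eqP bC; apply/esym.
  by apply: (closer_edge_eq zb); rewrite ?bC.
(* An equidistant neighbour v of u is at the same distance 1 from u and from
   its partner b. The edge (x', y') is (x, y) or (y, x). *)
have equi_edge x' y' u v b : equidistant E x' y' = equidistant E x y ->
    partner x' y' u b -> v \in equidistant E x y -> E u v -> E b v.
  move=> eq' /and3P[ub /eqP uC /eqP bC] veq uv.
  apply: (dist1_edge E_connected).
  rewrite -(dist_edge E_irrefl E_connected uv).
  have : v \notin C u b by move: veq; rewrite uC -eq' !inE; lia.
  have : v \notin C b u by move: veq; rewrite bC -eq' !inE; lia.
  rewrite !inE; lia.
have equiC : equidistant E y x = equidistant E x y.
  by apply/setP => z; rewrite !inE eq_sym.
have phi_edge u v : E u v -> E (phi u) (phi v).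
  move=> uv; have vu : E v u by rewrite E_sym.
  have [[b ub pu]|[b ub pu]|ueq] := trich u;
  have [[c vc pv]|[c vc pv]|veq] := trich v.
  - have [b' bb' vb'] := partner_step ub (partner_closer vc) uv.
    by rewrite pu pv (partner_uniq vc vb').
  - have uw := cross u v uv (partner_closer ub) (partner_closer vc).
    by rewrite -uw phiK uw.
  - by rewrite pu (phi_id v) //; apply: equi_edge ub veq uv.
  - have vw := cross v u vu (partner_closer vc) (partner_closer ub).
    by rewrite -vw phiK vw.
  - have [b' bb' vb'] := partner_step ub (partner_closer vc) uv.
    by rewrite pu pv (partner_uniq vc vb').
  - by rewrite pu (phi_id v) //; apply: equi_edge ub veq uv.
  - by rewrite (phi_id u) // pv E_sym; apply: equi_edge vc ueq vu.
  - by rewrite (phi_id u) // pv E_sym; apply: equi_edge vc ueq vu.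
  - by rewrite !phi_id.
exists phi; split=> //.
- by apply: phiQ; rewrite /Q partner_refl.
- apply/setP => -[z w]; rewrite inE /=; apply/and3P/imsetP => [[zw zC wC]|].
    by exists z => //; rewrite (cross z w).
  move=> [z' zC [-> ->]]; have [b zb] := partner_ex xy zC.
  have -> : phi z' = b by apply: phiQ; rewrite /Q zb.
  split=> //; first by case/and3P: zb.
  by move: zb; rewrite partnerC => /partner_closer.
- split; first by exists phi.
  move=> u v; apply/idP/idP => [/phi_edge|/phi_edge//].
  by rewrite !phiK.
Qed.

End Reflection.

Theorem lemma4p1 (R : realType) (V : finType) (E : rel V)
    (V_nonempty : (0 < #|V|)%N)
    (E_sym : symmetric E) (E_irrefl : irreflexive E)
    (E_connected : forall x y : V, connect E x y)
    (rigid : avg_ric R E * avg_dist R E = avg_deg R E) :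
  reflective E.
Proof.
move=> x y; apply: (reflection_ex E_sym E_irrefl E_connected) => {x y} x y a.
apply: (closer_neighbour (R := R)) => // z u v.
exact: rigid_ric.
Qed.
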